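(* For every finite bipartite graph $H = (V_0, W_0, E_0)$ (with $E_0 \subseteq V_0 \times W_0$) and every $\varepsilon \in (0,1]$, there exist a finite bipartite graph $G = (V, W, E)$ (with $E \subseteq V \times W$) and a real number $\delta > 0$, depending only on $H$ and $\varepsilon$, such that the following holds. Let $(X, \mathcal{B}, \mu)$ be any probability space, and for every $(v,w) \in V \times W$ let $A_{v,w} \in \mathcal{B}$ be a measurable set, such that for all $(v,w) \in E$ and all $(v',w') \in (V \times W) \setminus E$ we have $\mu(A_{v,w}) - \mu(A_{v',w'}) \geq \varepsilon$. Then there exist $V' \subseteq V$ and $W' \subseteq W$ such that, setting $E' = E \cap (V' \times W')$, the induced bipartite subgraph $H' = (V', W', E')$ of $G$ is isomorphic to $H$ (as a bipartite graph), and $$\mu\left( \left( \bigcap_{(v,w) \in E'} A_{v,w} \right) \cap \left( \bigcap_{(v,w) \in (V' \times W') \setminus E'} \left( X \setminus A_{v,w} \right) \right) \right) \geq \delta.$$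
   Context: A probability space $(X,\mathcal{B},\mu)$ consists of a set $X$, a $\sigma$-algebra $\mathcal{B}$ of subsets of $X$, and a countably additive probability measure $\mu$ on $\mathcal{B}$. A bipartite graph $(V,W,E)$ has vertex parts $V$, $W$ and edge set $E \subseteq V \times W$; its induced subgraph on $V' \subseteq V$, $W' \subseteq W$ is $(V', W', E \cap (V' \times W'))$. *)

(* Defs.v *)
From HB Require Import structures.
From mathcomp Require Import all_boot all_order all_algebra.
From mathcomp Require Import all_classical all_reals all_analysis.

Set Implicit Arguments.
Unset Strict Implicit.
Unset Printing Implicit Defensive.

Record bigraph : Type := BiGraph {
  lpart : finType;
  rpart : finType;
  edges : {set lpart * rpart}
}.

Section Bigraph.
Local Open Scope set_scope.

Definition bigraph_iso (G H : bigraph) : Prop :=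
  exists (f : lpart G -> lpart H) (g : rpart G -> rpart H),
    [/\ bijective f, bijective g &
        forall x y, ((x, y) \in edges G) = ((f x, g y) \in edges H)].

(* [setX] is qualified because classical_sets shadows the finset product. *)
Definition rect (G : bigraph) (V' : {set lpart G}) (W' : {set rpart G}) :
    {set lpart G * rpart G} := finset.setX V' W'.

Definition induced_edges (G : bigraph) (V' : {set lpart G})
    (W' : {set rpart G}) : {set lpart G * rpart G} :=
  edges G :&: rect V' W'.

Definition induced_nonedges (G : bigraph) (V' : {set lpart G})
    (W' : {set rpart G}) : {set lpart G * rpart G} :=
  rect V' W' :\: induced_edges V' W'.

(* The vertex parts are the subtypes carried by V' and W'; accordingly the
   edges are the pairs whose underlying pair lies in [induced_edges]. *)
Definition induced_subgraph (G : bigraph) (V' : {set lpart G})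
    (W' : {set rpart G}) : bigraph :=
  @BiGraph {v : lpart G | v \in V'} {w : rpart G | w \in W'}
    (finset (fun p : {v : lpart G | v \in V'} * {w : rpart G | w \in W'} =>
       (val p.1, val p.2) \in induced_edges V' W')).

End Bigraph.

(* Main.v *)
Require Import Defs.
From HB Require Import structures.
From mathcomp Require Import all_boot all_order all_algebra.
From mathcomp Require Import all_classical all_reals all_analysis.
From mathcomp Require Import lra ring.

Set Implicit Arguments.
Unset Strict Implicit.
Unset Printing Implicit Defensive.

Import Order.TTheory GRing.Theory Num.Theory.

(** Take [G] to be the membership graph between [n] points and their subsets.
A point [x] of the probability space yields a graph [F], the set of [(v, w)]
with [x] in [A v w]; the gap hypothesis says that on average [F] is positively
correlated with [G]. It suffices that a correlated [F] always coincides with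
[G] on some copy of [H]: integrating over [x] then gives a total measure
bounded below, shared among finitely many possible copies.

Many points [v] have a row that is correlated. By Ramsey's theorem, applied to
the colouring of [k]-subsets of these points by a 0/1 pattern that no subset
[w] agreeing with [F] realizes, there is a large set [t] that is homogeneous.
Cut [t] into blocks. On a block, [w] is balanced up to a small error (second
moment), so if [F] and [G] agree noticeably more than half of the time, then a
positive fraction of the [w] meet the agreement set of the block both inside
and outside [w]. Some [w] is of this kind for [k] blocks at once, hence
realizes any pattern on a suitable choice of one point per block. So no
pattern is missing, and every right vertex of [H] can be realized over the
same [k] points. *)

(** * Ramsey's theorem for subsequences of a sequence *)

Section Ramsey.
Variable C : finType.

Lemma pigeonhole_count (T : Type) n (f : T -> C) t : #|C| * n < size t ->
  exists a, n < count (fun x => f x == a) t.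
Proof.
move=> nt; apply/existsP; apply: contraLR nt.
rewrite negb_exists -leqNgt => /forallP small.
have -> : size t = \sum_a count (fun x => f x == a) t.
  under eq_bigr do rewrite -sum1_count.
  rewrite -sum1_size (exchange_big_dep predT) //=.
  by apply: eq_bigr => x _; rewrite (big_pred1 (f x)) // => a; rewrite eq_sym.
by rewrite -sum_nat_const; apply: leq_sum => a _; rewrite leqNgt.
Qed.

Section EndHomogeneous.
Variable T : eqType.
Implicit Types (s t u : seq T) (c : seq T -> C).

(* Each entry carries the common colour of the [k.+1]-subsequences that start
   at it. *)
Fixpoint end_homogeneous k c (p : seq (T * C)) :=
  if p is (x, a) :: p' then
    (forall u, subseq u (unzip1 p') -> size u = k -> c (x :: u) = a) /\
    end_homogeneous k c p'
  else True.

Lemma end_homogeneous_filter k c P p :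
  end_homogeneous k c p -> end_homogeneous k c [seq y <- p | P y].
Proof.
elim: p => [|[x a] p IHp] //= [hx /IHp hp]; case: ifP => //= _;
  split => // u us.
by apply: hx; apply: subseq_trans us _; apply/map_subseq/filter_subseq.
Qed.

Lemma end_homogeneous_const k c a p : all (fun y => y.2 == a) p ->
  end_homogeneous k c p ->
  forall u, subseq u (unzip1 p) -> size u = k.+1 -> c u = a.
Proof.
elim: p => [_ _ u /eqP-> //|[x b] p IHp] /=.
move=> /andP[/eqP ba pa] [hx hp] [//|y u] /=.
by case: eqP => [->|_] up; [case=> su;
  rewrite hx | exact: (IHp pa hp (y :: u))].
Qed.

End EndHomogeneous.

(** Induction on [k]. Split off the first entry [x] and apply the case [k] to the colouring
    [c (x :: u)] of the rest; repeating this inside the homogeneous part yields an end-homogeneous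
    sequence. Pigeonhole on its attached colours then leaves [n] entries with one colour. *)
Theorem ramsey k n : exists N, forall (T : eqType) (c : seq T -> C) s,
  N <= size s -> exists t a, [/\ subseq t s, size t = n &
    forall u, subseq u t -> size u = k -> c u = a].
Proof.
elim: k n => [|k IHk] n.
  exists n => T c s ns; exists (take n s), (c [::]); split.
  - exact: take_subseq.
  - by rewrite size_takel.
  - by move=> u _ /size0nil ->.
have end_ramsey L : exists N, forall (T : eqType) (c : seq T -> C) s,
    N <= size s -> exists p, [/\ subseq (unzip1 p) s,
      size p = L & end_homogeneous k c p].
  elim: L => [|L [N hN]]; first by exists 0 => T c s _; exists [::];
    rewrite sub0seq.
  have [N' hN'] := IHk N; exists N'.+1 => T c [//|x s] /= Ns.
  have [t [a [ts tN ht]]] := hN' T (fun u => c (x :: u)) s Ns.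
  have [|p [pt pL hp]] := hN T c t; first by rewrite tN.
  exists ((x, a) :: p); rewrite /= eqxx (subseq_trans pt ts) pL; split=> //.
  by split=> // u up; apply: ht; apply: subseq_trans up pt.
have [N hN] := end_ramsey (#|C| * n).+1;
  exists N => T c s /hN-/(_ c)[p [ps sp hp]].
have [|a na] := @pigeonhole_count _ n snd p; first by rewrite sp.
pose q := [seq y <- p | y.2 == a].
have qp : subseq (unzip1 q) s.
  by apply: subseq_trans ps; apply/map_subseq/filter_subseq.
exists (take n (unzip1 q)), a; split.
- exact: subseq_trans (take_subseq _ _) qp.
- by rewrite size_takel // size_map size_filter ltnW.
move=> u ut; apply: (end_homogeneous_const (a := a) (p := q)).
- exact: filter_all.
- exact: end_homogeneous_filter.
- exact: subseq_trans ut (take_subseq _ _).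
Qed.

End Ramsey.

Local Open Scope classical_set_scope.
Local Open Scope ring_scope.

Lemma sumr_const_mul (R : pzRingType) (I : finType) (a : R) :
  \sum_(i : I) a = a * #|I|%:R.
Proof. by rewrite sumr_const mulr_natr. Qed.

(** * Signs on the cube of subsets, and blocks split by a subset *)

Section Cube.
Variables (R : realFieldType) (V : finType).
Implicit Types (v : V) (w : {set V}) (T : seq V).

Definition spin v w : R := if v \in w then 1 else - 1.

Definition flip v w : {set V} := finset (fun v' => (v' \in w) (+) (v' == v)).

Lemma flipK v : involutive (flip v).
Proof. by move=> w; apply/setP => v'; rewrite !inE -addbA addbb addbF. Qed.

Lemma spin_flip v v' w : spin v' (flip v w) = (-1) ^+ (v' == v) * spin v' w.
Proof.
by rewrite /spin inE; case: (v' \in w); case: (v' == v) => /=; ring.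
Qed.

Lemma spin_sqr v w : spin v w ^+ 2 = 1.
Proof. by rewrite /spin; case: ifP => _; ring. Qed.

Lemma sum_flip v (f : {set V} -> R) : \sum_w f (flip v w) = \sum_w f w.
Proof. by rewrite [RHS](reindex_inj (inv_inj (flipK v))). Qed.

Lemma sum_antiflip v (f : {set V} -> R) :
  (forall w, f (flip v w) = - f w) -> \sum_w f w = 0.
Proof.
move=> fv; have := sum_flip v f; under eq_bigr do rewrite fv.
rewrite sumrN; lra.
Qed.

Lemma sum_spin v : \sum_w spin v w = 0.
Proof.
by apply: (@sum_antiflip v) => w; rewrite spin_flip eqxx expr1 mulN1r.
Qed.

(** The signs are orthogonal: the cross term of the head [v] with the tail is negated by [flip v],
    as [v] does not recur, so only the squares remain. *)
Lemma sum_spin_sqr T : uniq T ->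
  \sum_w (\sum_(v <- T) spin v w) ^+ 2 = (size T * #|{set V}|)%:R.
Proof.
elim: T => [_|v T IHT /andP[vT uT]].
  by rewrite big1 // => w _; rewrite big_nil expr0n.
under eq_bigr => w _ do rewrite big_cons sqrrD spin_sqr -addrA.
rewrite big_split /= big_split /= IHT // sumr_const -mulr_natr mul1r.
rewrite (_ : \sum_w _ *+ 2 = 0) ?add0r -?natrD -?mulSn //.
apply: (@sum_antiflip v) => w; rewrite spin_flip eqxx expr1 mulN1r.
rewrite !mulNr mulNrn; congr (- (_ * _ *+ 2)).
apply: eq_big_seq => v' v'T; rewrite spin_flip.
by rewrite (negbTE (memPn vT _ v'T)) mul1r.
Qed.

Variable F : V -> {set V} -> bool.

Definition agree v w := F v w == (v \in w).

(** On such a block, a point where [F] agrees with membership can be picked inside or outside [w] at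
    will. *)
Definition split_block w T :=
  has (fun v => agree v w && (v \in w)) T &&
  has (fun v => agree v w && (v \notin w)) T.

(** Turns correlation into agreement: the last term vanishes when summed over [w]. *)
Lemma agree_spin v w :
  2 * (agree v w)%:R - 1 = 2 * (spin v w * (F v w)%:R) - spin v w.
Proof.
by rewrite /agree /spin; case: (F v w); case: (v \in w) => /=; ring.
Qed.

(** If [w] does not split [T], all agreement lies on one side of [w], so its excess over one half is
    at most the imbalance of [w] on [T]. *)
Lemma sum_agree_le w T : \sum_(v <- T) (2 * (agree v w)%:R - 1 : R) <=
  (size T)%:R * (split_block w T)%:R + `|\sum_(v <- T) spin v w|.
Proof.
have [_|] := boolP (split_block w T).
  rewrite mulr1 -[leLHS]addr0 lerD // -sum1_size natr_sum.
  by apply: ler_sum => v _; case: (agree v w) => /=; lra.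
rewrite mulr0 add0r negb_and => /orP[] /hasPn noT.
- rewrite -normrN; apply: le_trans (ler_norm _); rewrite -sumrN.
  rewrite big_seq [leRHS]big_seq; apply: ler_sum => v /noT; rewrite /spin.
  by case: (agree v w); case: (v \in w) => //= _; lra.
- apply: le_trans (ler_norm _).
  rewrite big_seq [leRHS]big_seq; apply: ler_sum => v /noT; rewrite /spin.
  by case: (agree v w); case: (v \in w) => //= _; lra.
Qed.

(** Double counting of the excess agreement. The imbalance is controlled by its second moment, and
    blocks of size at least [4 / eta ^+ 2] make the total error at most half of the lower bound. *)
Lemma split_block_card (eta : R) T : 0 < eta -> uniq T ->
  {in T, forall v, eta / 2 * #|{set V}|%:R <= \sum_w spin v w * (F v w)%:R} ->
  4 <= eta ^+ 2 * (size T)%:R ->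
  eta / 2 * #|{set V}|%:R <= \sum_w (split_block w T)%:R.
Proof.
move=> eta0 uT rowT sizeT.
set N : R := #|{set V}|%:R; set b : R := (size T)%:R.
set g := \sum_w (split_block w T)%:R.
have b0 : 0 < b.
  rewrite lt_neqAle ler0n andbT; apply: contraTneq sizeT => b0.
  by rewrite -/b -b0 mulr0 -ltNge ltr0n.
have lower : eta * N * b <= \sum_w \sum_(v <- T) (2 * (agree v w)%:R - 1).
  rewrite exchange_big /= /b -sum1_size natr_sum mulr_sumr.
  rewrite big_seq [leRHS]big_seq; apply: ler_sum => v /rowT.
  under [X in _ -> _ <= X]eq_bigr do rewrite agree_spin.
  by rewrite sumrB sum_spin -mulr_sumr -/N; lra.
have upper : \sum_w \sum_(v <- T) (2 * (agree v w)%:R - 1) <=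
    b * g + (eta * b / 4 * N + b * N / (eta * b)).
  have -> : b * g + (eta * b / 4 * N + b * N / (eta * b)) =
      \sum_w (b * (split_block w T)%:R +
        (eta * b / 4 + (\sum_(v <- T) spin v w) ^+ 2 / (eta * b))).
    rewrite !big_split /= sumr_const_mul -mulr_sumr -mulr_suml sum_spin_sqr //.
    by rewrite natrM.
  apply: ler_sum => w _; apply: le_trans (sum_agree_le w T) _.
  rewrite lerD2l; set S := \sum_(v <- T) _.
  have eb0 : 0 < eta * b by rewrite mulr_gt0.
  rewrite -(real_normK (num_real S)); set y := `|S|.
  (* Completing the square bounds [y] by a constant plus a multiple of [y ^+ 2], to which
     [sum_spin_sqr] applies. *)
  have -> : eta * b / 4 + y ^+ 2 / (eta * b) =
      y + (y - eta * b / 2) ^+ 2 / (eta * b) by field; lra.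
  by rewrite lerDl divr_ge0 ?sqr_ge0 // ltW.
have N0 : 0 <= N by rewrite ler0n.
have eN : b * N / (eta * b) <= eta * b / 4 * N.
  rewrite ler_pdivrMr ?mulr_gt0 //.
  have -> : eta * b / 4 * N * (eta * b) = (eta ^+ 2 * b / 4) * (b * N) by ring.
  have q1 : 1 <= eta ^+ 2 * b / 4 by move: sizeT; rewrite -/b; lra.
  by apply: ler_peMl => //; apply: mulr_ge0 => //; apply: ltW.
rewrite -(ler_pM2l b0); lra.
Qed.

(** Greedy choice: each split block supplies the point for the next bit, and the other blocks are
    skipped. *)
Lemma split_block_pattern w (s : seq bool) (tt : seq (seq V)) :
  (size s <= count (split_block w) tt)%N ->
  exists2 u, subseq u (flatten tt) &
    all2 (fun v b => agree v w && ((v \in w) == b)) u s.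
Proof.
elim: tt s => [|T tt IHtt] s /=.
  by rewrite leqn0 => /nilP ->; exists [::].
case: s => [|b s] /=; first by exists [::]; rewrite ?sub0seq.
have [sT|_] := boolP (split_block w T); last first.
  rewrite add0n => /(IHtt (b :: s))[u us ps]; exists u => //.
  exact: subseq_trans us (suffix_subseq _ _).
rewrite add1n ltnS => /IHtt[u us ps].
have [v vT pv] : exists2 v, v \in T & agree v w && ((v \in w) == b).
  case/andP: sT => /hasP[v vT pv] /hasP[v' v'T pv'].
  by case: b; [exists v; rewrite ?eqb_id | exists v'; rewrite ?eqbF_neg].
exists (v :: u); last by rewrite /= pv.
by rewrite -cat1s cat_subseq // sub1seq.
Qed.

End Cube.

(** * Realizing every 0/1 pattern over the same points *)

Lemma all_patterns (R : archiRealFieldType) k (eta : R) : 0 < eta ->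
  exists2 n, (0 < n)%N & forall F : 'I_n -> {set 'I_n} -> bool,
    eta * n%:R * #|{set 'I_n}|%:R <= \sum_v \sum_w spin R v w * (F v w)%:R ->
    exists u, [/\ uniq u, size u = k & forall s, size s = k ->
      exists w, all2 (fun v b => agree F v w && ((v \in w) == b)) u s].
Proof.
move=> eta0.
have bound_nat (x y : R) : 0 < x -> 0 <= y -> exists n, y <= x * n%:R.
  move=> x0 y0; exists (Num.bound (y / x)).
  by rewrite mulrC -ler_pdivrMr // ltW // archi_boundP // divr_ge0 // ltW.
have [b sizeb] : exists b, 4 <= eta ^+ 2 * b%:R by apply: bound_nat;
  rewrite ?exprn_gt0.
have [M0 hM0] : exists M, k%:R <= eta / 2 * M%:R by apply: bound_nat;
  rewrite ?divr_gt0.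
(* [M0] blocks suffice for the averaging; the summand [k] ensures that the homogeneous set has at
   least [k] points. *)
pose M := (k + M0)%N.
have hM : k%:R <= eta / 2 * M%:R.
  by apply: le_trans hM0 _; rewrite ler_pM2l ?divr_gt0 // ler_nat leq_addl.
have [N ramseyN] := ramsey (option (k.-tuple bool)) k (M * b).
have [n0 hn0] : exists n, N%:R <= eta / 2 * n%:R by apply: bound_nat;
  rewrite ?divr_gt0.
pose n := n0.+1; exists n => // F sumF.
have hn : N%:R <= eta / 2 * n%:R.
  by apply: le_trans hn0 _; rewrite ler_pM2l ?divr_gt0 // ler_nat.
set W : R := #|{set 'I_n}|%:R in sumF *.
have W0 : 0 < W by rewrite ltr0n; apply/card_gt0P; exists finset.set0.
pose row v := \sum_w spin R v w * (F v w)%:R.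
pose V1 := finset (fun v => eta / 2 * W <= row v).
(* A row sum is at most [W], and below [eta / 2 * W] outside [V1]; an average of [eta * W] thus
   forces [eta / 2 * n] rows into [V1]. *)
have cardV1 : (N <= #|V1|)%N.
  rewrite -(ler_nat R); apply: le_trans hn _.
  suff : eta * n%:R * W <= (#|V1|%:R + eta / 2 * n%:R) * W.
    by rewrite ler_pM2r //; lra.
  apply: le_trans sumF _.
  have -> : (#|V1|%:R + eta / 2 * n%:R) * W =
      \sum_(v < n) ((v \in V1)%:R + eta / 2) * W.
    rewrite -mulr_suml big_split /= sumr_const_mul card_ord.
    by rewrite -natr_sum -sum1_card big_mkcond.
  apply: ler_sum => v _; rewrite -/(row v).
  have [_|vV1] := boolP (v \in V1).
    rewrite mulrDl mul1r -[leLHS]addr0 lerD //;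
      last by rewrite mulr_ge0 ?ltW ?divr_gt0.
    rewrite /W -sum1_card natr_sum; apply: ler_sum => w _.
    by rewrite /spin; case: ifP; case: (F v w) => _ /=; lra.
  by rewrite add0r ltW //; move: vV1; rewrite inE -ltNge.
pose realized u s := [exists w : {set 'I_n},
  all2 (fun v b => agree F v w && ((v \in w) == b)) u s].
pose missing u := [pick s : k.-tuple bool | ~~ realized u s].
have [|t [a [tV1 sizet ht]]] := ramseyN _ missing (enum V1);
  first by rewrite -cardE.
have uniqt : uniq t by apply: subseq_uniq tV1 (enum_uniq _).
have b0 : (0 < b)%N.
  by case: b sizeb {ramseyN sizet} => //; rewrite mulr0 leNgt ltr0n.
(* Colour [None] means that nothing is missing, so any [k] points of [t] will do. A colour [Some s]
   is refuted below. *)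
case: a ht => [s|] ht; last first.
  have sizeu : size (take k t) = k.
    rewrite size_takel // sizet; apply: leq_trans (leq_pmulr _ b0).
    exact: leq_addr.
  exists (take k t); split; rewrite ?take_uniq // => s /eqP sizes.
  have := ht _ (take_subseq _ _) sizeu; rewrite /missing.
  by case: pickP => // /(_ (Tuple sizes)) /negbFE/existsP.
pose tt := reshape (nseq M b) t.
have flattt : flatten tt = t by rewrite reshapeKr // sizet sumn_nseq mulnC.
have shapett : shape tt = nseq M b
  by rewrite reshapeKl // sizet sumn_nseq mulnC.
(* Averaging over [w]: each of the [M] blocks is split by a fraction at least [eta / 2] of all [w],
   and [eta / 2 * M] is at least [k]. *)
have [w countw] : exists w : {set 'I_n}, (k <= count (split_block F w) tt)%N.
  apply/existsP; apply: contraT; rewrite negb_exists => /forallP small.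
  have upper : \sum_w (count (split_block F w) tt)%:R + W <= k%:R * W.
    rewrite /W -sumr_const_mul -sum1_card natr_sum -big_split /=.
    by apply: ler_sum => w _; rewrite -natrD addn1 ler_nat ltnNge.
  suff : k%:R * W <= \sum_w (count (split_block F w) tt)%:R by lra.
  have -> : \sum_w (count (split_block F w) tt)%:R =
      \sum_(T <- tt) \sum_w (split_block F w T)%:R :> R.
    rewrite exchange_big /=; apply: eq_bigr => w _.
    by rewrite -sum1_count big_mkcond natr_sum; apply: eq_bigr => T _;
      case: ifP.
  apply: (@le_trans _ _ (\sum_(T <- tt) eta / 2 * W)).
    have -> : \sum_(T <- tt) eta / 2 * W = eta / 2 * (size tt)%:R * W.
      rewrite -sum1_size natr_sum mulr_sumr mulr_suml.
      by apply: eq_bigr => T _; rewrite mulr1.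
    by rewrite size_reshape size_nseq ler_pM2r.
  rewrite big_seq [leRHS]big_seq; apply: ler_sum => T Ttt.
  have Tt : subseq T t.
    rewrite -flattt; case/splitPr: Ttt => p1 p2; rewrite flatten_cat /=.
    exact: subseq_trans (prefix_subseq _ _) (suffix_subseq _ _).
  have sizeT : size T = b.
    by apply/eqP; have := map_f size Ttt;
      rewrite -/(shape tt) shapett mem_nseq => /andP[].
  apply: split_block_card => //; rewrite ?sizeT //;
    first exact: subseq_uniq Tt uniqt.
  by move=> v /(mem_subseq Tt)/(mem_subseq tV1); rewrite mem_enum inE.
(* This [w] realizes [s] itself on some [u] within [t], although [s] is recorded as missing
   there. *)
have [|u ut pu] := @split_block_pattern _ F w s tt; first by rewrite size_tuple.
rewrite flattt in ut.
have sizeu : size u = k by move: pu; rewrite all2E => /andP[/eqP ->];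
  rewrite size_tuple.
have := ht u ut sizeu; rewrite /missing.
case: pickP => // s' ns' [ss']; case/existsP: ns'; exists w; by rewrite ss'.
Qed.

Lemma all_patterns_fun (R : archiRealFieldType) (K : finType) (eta : R) :
  0 < eta ->
  exists2 n, (0 < n)%N & forall F : 'I_n -> {set 'I_n} -> bool,
    eta * n%:R * #|{set 'I_n}|%:R <= \sum_v \sum_w spin R v w * (F v w)%:R ->
    exists2 phi : K -> 'I_n, injective phi & forall s : K -> bool,
      exists w, forall z, agree F (phi z) w /\ (phi z \in w) = s z.
Proof.
move=> /(all_patterns #|K|)[n n0 hn]; exists n => // F /hn[u [uniqu sizeu hu]].
pose phi (z : K) := nth (Ordinal n0) u (enum_rank z); exists phi => [z z'|s].
  by move/eqP; rewrite nth_uniq ?sizeu // => /eqP /val_inj /enum_rank_inj.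
have sizes : size [seq s z | z <- enum K] = #|K| by rewrite size_map -cardE.
have [w] := hu _ sizes;
  rewrite all2E => /andP[_ /(all_nthP (Ordinal n0, true)) hw].
exists w => z; have /hw : (enum_rank z < size (zip u [seq s z | z <- enum
  K]))%N.
  by rewrite size_zip sizes sizeu minnn.
rewrite nth_zip ?sizes //= => /andP[? /eqP ->]; split => //.
by rewrite (nth_map z) -?cardE // nth_enum_rank.
Qed.

(** * Copies of [H] in the membership graph *)

Lemma bigraph_iso_image (G H : bigraph) (phi : lpart H -> lpart G)
    (psi : rpart H -> rpart G) : injective phi -> injective psi ->
  (forall v w, ((phi v, psi w) \in edges G) = ((v, w) \in edges H)) ->
  bigraph_iso (induced_subgraph (phi @: finset.setT)%SET (psi @:
    finset.setT)%SET) H.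
Proof.
move=> phi_inj psi_inj edgesE.
(* The isomorphism runs from the induced subgraph to [H], so the embeddings have to be inverted on
   their images. *)
have corestrict (T U : finType) (f : T -> U) : injective f ->
    exists2 g : {y | y \in (f @: finset.setT)%SET} -> T,
      bijective g & forall y, f (g y) = val y.
  move=> f_inj.
  have fT x : f x \in (f @: finset.setT)%SET by apply: imset_f;
    rewrite finset.in_setT.
  have preim (y : {y | y \in (f @: finset.setT)%SET}) : exists x, f x == val y.
    by case: y => y /= /imsetP[x _ ->]; exists x.
  have fg y : f (xchoose (preim y)) = val y by apply/eqP/(xchooseP (preim y)).
  exists (fun y => xchoose (preim y)) => //.
  exists (fun x => exist _ (f x) (fT x)) => [y|x].
    by apply: val_inj; rewrite /= fg.
  by apply: f_inj; rewrite fg.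
have [f f_bij fE] := corestrict _ _ phi phi_inj.
have [g g_bij gE] := corestrict _ _ psi psi_inj.
exists f, g; split => // x y; rewrite -edgesE fE gE !inE /=.
by rewrite (valP x) (valP y) !andbT.
Qed.

Definition cube_bigraph n : bigraph :=
  @BiGraph 'I_n {set 'I_n} (finset (fun p : 'I_n * {set 'I_n} => p.1 \in p.2)).

(* The right vertices of [H] are added on the left, with the identity relation,
   so that distinct right vertices have distinct patterns. *)
Lemma agreeing_copy (R : archiRealFieldType) (H : bigraph) (eta : R) :
  0 < eta ->
  exists2 n, (0 < n)%N & forall F : 'I_n -> {set 'I_n} -> bool,
    eta * n%:R * #|{set 'I_n}|%:R <= \sum_v \sum_w spin R v w * (F v w)%:R ->
    exists (V' : {set lpart (cube_bigraph n)}) (W' : {set rpart (cube_bigraph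
      n)}),
      bigraph_iso (induced_subgraph V' W') H /\
      forall v w, v \in V' -> w \in W' -> agree F v w.
Proof.
move=> /(all_patterns_fun (lpart H + rpart H)%type)[n n0 hn].
exists n => // F /hn[phi phi_inj hphi].
have [psi hpsi] : exists psi : rpart H -> {set 'I_n}, forall y,
    (forall z, agree F (phi z) (psi y)) /\
    (forall x, (phi (inl x) \in psi y) = ((x, y) \in edges H)) /\
    (forall y', (phi (inr y') \in psi y) = (y' == y)).
  suff /choice[psi ?] : forall y, exists w, (forall z, agree F (phi z) w) /\
    (forall x, (phi (inl x) \in w) = ((x, y) \in edges H)) /\
    (forall y', (phi (inr y') \in w) = (y' == y)) by exists psi.
  move=> y; have [w hw] := hphi (fun z => match z with
    | inl x => (x, y) \in edges H | inr y' => y' == y end).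
  exists w; split=> [z|]; first by case: (hw z).
  by split=> [x|y']; rewrite (hw _).2.
exists ((fun x => phi (inl x)) @: finset.setT)%SET, (psi @: finset.setT)%SET;
  split.
  apply: bigraph_iso_image.
  - by move=> x x' /phi_inj[].
  - move=> y y' eq_psi; apply/eqP.
    by rewrite -(hpsi y').2.2 -eq_psi (hpsi y).2.2.
  - by move=> x y; rewrite inE /= (hpsi y).2.1.
by move=> _ _ /imsetP[x _ ->] /imsetP[y _ ->]; exact: (hpsi y).1.
Qed.

(** * Integration over the probability space *)

Lemma measure_comb_le d (X : measurableType d) (R : realType)
    (mu : probability X R) (I : finType) (a : I -> R) (S : I -> set X) (c : R) :
  (forall i, measurable (S i)) ->
  (forall x, \sum_i a i * \1_(S i) x <= c) ->
  \sum_i a i * fine (mu (S i)) <= c.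
Proof.
move=> mS le_c.
have intS i : mu.-integrable setT (fun x => (a i)%:E * (\1_(S i) x)%:E)%E.
  by apply: integrableZl => //; apply: integrable_indic.
have : (\int[mu]_x (\sum_i (a i)%:E * (\1_(S i) x)%:E) <= \int[mu]_x c%:E)%E.
  apply: le_integral => //.
  - exact: integrable_sum.
  - exact: (finite_measure_integrable_cst mu c).
  - move=> x _; under eq_bigr do rewrite -EFinM.
    by rewrite sumEFin lee_fin.
rewrite integral_cst //= probability_setT mule1 integral_sum //.
have intE i : (\int[mu]_x ((a i)%:E * (\1_(S i) x)%:E))%E =
    (a i * fine (mu (S i)))%:E.
  rewrite integralZl //; last exact: integrable_indic.
  by rewrite integral_indic // setIT EFinM fineK // fin_num_measure.
by rewrite (eq_bigr _ (fun i _ => intE i)) sumEFin lee_fin.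
Qed.

(** Pairing [w] with [flip v w] yields a gap of [eps] per pair; summing over all [w] meets each pair
    twice, hence the half. *)
Lemma sum_spin_gap (R : realFieldType) (V : finType) (v : V) (eps : R)
    (m : {set V} -> R) :
  (forall w w' : {set V}, v \in w -> v \notin w' -> eps <= m w - m w') ->
  eps / 2 * #|{set V}|%:R <= \sum_w spin R v w * m w.
Proof.
move=> gap.
have : \sum_(w : {set V}) eps <= 2 * \sum_w spin R v w * m w.
  pose f w := spin R v w * m w.
  have -> : 2 * \sum_w f w = \sum_w (f w + f (flip v w)).
    by rewrite big_split /= (sum_flip v f); ring.
  apply: ler_sum => w _; rewrite /f spin_flip eqxx expr1 mulN1r /spin.
  have fv : (v \in flip v w) = ~~ (v \in w) by rewrite inE eqxx addbT.
  case: ifP fv => [vw|/negbT vw] /= fv.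
  - by have := gap w (flip v w) vw (negbT fv); lra.
  - by have := gap (flip v w) w fv vw; lra.
by rewrite sumr_const_mul; lra.
Qed.

Theorem theorem1 (R : realType) (H : bigraph) (eps : R)
    (eps_gt0 : 0 < eps) (eps_le1 : eps <= 1) :
  exists (G : bigraph) (delta : R), 0 < delta /\
    forall (d : measure_display) (X : measurableType d)
           (mu : probability X R) (A : lpart G -> rpart G -> set X),
      (forall v w, measurable (A v w)) ->
      (forall v w v' w', (v, w) \in edges G -> (v', w') \notin edges G ->
         (eps%:E <= mu (A v w) - mu (A v' w'))%E) ->
      exists (V' : {set lpart G}) (W' : {set rpart G}),
        bigraph_iso (induced_subgraph V' W') H /\
        (delta%:E <=
           mu ((\bigcap_(p in [set` induced_edges V' W']) A p.1 p.2) `&`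
               (\bigcap_(p in [set` induced_nonedges V' W']) ~` A p.1 p.2)))%E.
Proof.
(* The mean correlation will be at least [eps / 2]; half of it is the threshold above which a point
   yields a copy. *)
have eta0 : 0 < eps / 4 by rewrite divr_gt0.
have [n n0 copy] := agreeing_copy H eta0.
pose G := cube_bigraph n; pose I := ({set lpart G} * {set rpart G})%type.
pose N : R := n%:R * #|{set 'I_n}|%:R.
have N0 : 0 < N.
  by rewrite mulr_gt0 ?ltr0n //; apply/card_gt0P; exists finset.set0.
have I0 : 0 < #|{: I}|%:R :> R.
  by rewrite ltr0n; apply/card_gt0P; exists (finset.set0, finset.set0).
(* [I] indexes all candidate copies. If each copy of [H] had measure below this value, integrating
   [pointwise] would give [eps / 2 - eps / 8 <= eps / 4]. *)
exists G, (eps / 8 / #|{: I}|%:R); split; first by rewrite !divr_gt0.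
move=> d X mu A mA gap; apply: contrapT => no_copy.
pose B (i : I) := (\bigcap_(p in [set` induced_edges i.1 i.2]) A p.1 p.2) `&`
  (\bigcap_(p in [set` induced_nonedges i.1 i.2]) ~` A p.1 p.2).
have mB i : measurable (B i).
  apply: measurableI; apply: fin_bigcap_measurable => //.
  by move=> p _; apply: measurableC.
pose iso (i : I) := `[< bigraph_iso (induced_subgraph i.1 i.2) H >].
pose S (j : 'I_n * {set 'I_n} + I) :=
  match j with inl p => A p.1 p.2 | inr i => B i end.
(* Correlation minus a penalty [N] for every copy of [H] on which the point agrees with [G]. *)
pose a (j : 'I_n * {set 'I_n} + I) : R :=
  match j with inl p => spin R p.1 p.2 | inr i => - (iso i)%:R * N end.
have mS j : measurable (S j) by case: j => [p|i]; [exact: mA | exact: mB].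
(* Below the threshold the penalty only helps. Otherwise [copy] provides a penalty of [N], which
   cancels the correlation, itself at most [N]. *)
have pointwise x : \sum_j a j * \1_(S j) x <= eps / 4 * N.
  rewrite big_sumType /=.
  under [X in _ + X]eq_bigr => i _ do rewrite mulNr mulNr.
  rewrite sumrN -(pair_bigA _ (fun v w => spin R v w * \1_(A v w) x)) /=.
  have sumB_ge0 : 0 <= \sum_(i : I) (iso i)%:R * N * \1_(B i) x.
    by apply: sumr_ge0 => i _; rewrite !mulr_ge0 // ltW.
  have [small|large] := ltP (\sum_v \sum_w spin R v w * \1_(A v w) x) (eps / 4
    * N).
    by lra.
  have [|V' [W' [isoVW agreeVW]]] := copy (fun v w => x \in A v w).
    by rewrite -mulrA.
  have : N <= \sum_(i : I) (iso i)%:R * N * \1_(B i) x.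
    rewrite (bigD1 (V', W')) //= -[leLHS]addr0 lerD //; last first.
      by apply: sumr_ge0 => i _; rewrite !mulr_ge0 // ltW.
    have -> : iso (V', W') by apply/asboolP.
    rewrite mul1r indicE mem_set ?mulr1 //.
    split=> -[v w] /=; rewrite /induced_nonedges /induced_edges /rect !inE /=.
      move=> /andP[vw /andP[vV wW]]; have := agreeVW v w vV wW.
      by rewrite /agree vw => /eqP /set_mem.
    move=> /andP[/nandP vw /andP[vV wW]]; have := agreeVW v w vV wW.
    case: vw => [/negbTE|]; last by rewrite vV wW.
    by rewrite /agree => -> /eqP /negbT; rewrite notin_setE.
  have : \sum_v \sum_w spin R v w * \1_(A v w) x <= N.
    have -> : N = \sum_(v < n) \sum_(w : {set 'I_n}) 1.
      by rewrite !sumr_const_mul card_ord mul1r mulrC.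
    apply: ler_sum => v _; apply: ler_sum => w _; rewrite indicE /spin.
    by case: (x \in _); case: ifP => _ /=; lra.
  have : 0 <= eps / 4 * N by rewrite mulr_ge0 // ltW.
  by lra.
have := measure_comb_le mu mS pointwise; rewrite big_sumType /=.
rewrite -(pair_bigA _ (fun v w => spin R v w * fine (mu (A v w)))) /=.
have lowerA : eps / 2 * N <= \sum_v \sum_w spin R v w * fine (mu (A v w)).
  have -> : eps / 2 * N = \sum_(v < n) eps / 2 * #|{set 'I_n}|%:R.
    by rewrite sumr_const_mul card_ord /N; ring.
  apply: ler_sum => v _; apply: sum_spin_gap => w w' vw vw'.
  rewrite -lee_fin EFinB !fineK ?fin_num_measure //.
  by apply: gap; rewrite inE.
have upperB : \sum_(i : I) (iso i)%:R * N * fine (mu (B i)) <= eps / 8 * N.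
  have -> : eps / 8 * N = \sum_(i : I) N * (eps / 8 / #|{: I}|%:R).
    by rewrite sumr_const_mul; field; rewrite gt_eqF.
  apply: ler_sum => i _; have [isoi|_] := boolP (iso i); last first.
    by rewrite !mul0r mulr_ge0 ?divr_ge0 // ltW.
  rewrite mul1r ler_pM2l // leNgt; apply/negP => large.
  apply: no_copy; exists i.1, i.2; split; first exact/asboolP.
  by rewrite -/(B i) -[mu (B i)]fineK ?fin_num_measure // lee_fin ltW.
under [X in _ + X]eq_bigr => i _ do rewrite mulNr mulNr.
rewrite sumrN.
have : 0 < eps / 4 * N by rewrite mulr_gt0.
by lra.
Qed.
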